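(* The minimal sizes of MSTD pairs are $(3,5)$ and $(4,4)$: that is, there exist MSTD pairs of these sizes, for example $A=\{0,1,4,6,7\},\ B=\{2,3,5\}$ and $A=\{0,1,4,6\},\ B=\{0,2,5,6\}$, and for every MSTD pair $(A,B)$ of finite sets of nonnegative integers whose size is not a given one of these sizes $(m,m')$, one has $|A|>m$ or $|B|>m'$ (where, since $A+B$ and $\pm(A-B)$ are symmetric in $A$ and $B$, sizes are considered up to interchanging $A$ and $B$).
   Context: For finite sets of integers $A,B$, $A+B=\{a+b:a\in A,b\in B\}$ and $\pm(A-B)=(A-B)\cup(B-A)=\{a-b,\,b-a:a\in A,b\in B\}$; $(A,B)$ is an MSTD pair if $|A+B|>|\pm(A-B)|$, and its size is $(|A|,|B|)$. A pair $(m,m')$ is called a minimal size of an MSTD pair if there is an MSTD pair of that size and for every MSTD pair $(A,B)$ not of size $(m,m')$, either $|A|>m$ or $|B|>m'$. *)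

(* Defs.v *)
From mathcomp Require Import all_boot all_order all_algebra.
From mathcomp Require Import finmap.

Set Implicit Arguments.
Unset Strict Implicit.
Unset Printing Implicit Defensive.

Import GRing.Theory.
Local Open Scope fset_scope.
Local Open Scope ring_scope.

Definition sumset (A B : {fset int}) : {fset int} :=
  [fset a + b | a in A, b in B].

Definition diffset (A B : {fset int}) : {fset int} :=
  [fset a - b | a in A, b in B].

Definition pm_diffset (A B : {fset int}) : {fset int} :=
  diffset A B `|` diffset B A.

Definition MSTD_pair (A B : {fset int}) : bool :=
  (#|` pm_diffset A B| < #|` sumset A B|)%N.

Definition pair_size (A B : {fset int}) : nat * nat := (#|` A|, #|` B|).

(* Sizes are ordered pairs, so [(m, m')] is minimal exactly when [(m', m)] is. *)
Definition minimal_size (s : nat * nat) : Prop :=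
  (exists A B : {fset int}, MSTD_pair A B /\ pair_size A B = s) /\
  (forall A B : {fset int}, MSTD_pair A B -> pair_size A B <> s ->
     (s.1 < #|` A|)%N \/ (s.2 < #|` B|)%N).

(* Main.v *)
Require Import Defs.
From mathcomp Require Import all_boot all_order all_algebra.
From mathcomp Require Import finmap.
From mathcomp Require Import zify.

Set Implicit Arguments.
Unset Strict Implicit.
Unset Printing Implicit Defensive.

Import GRing.Theory.
Local Open Scope fset_scope.
Local Open Scope ring_scope.

(** If A = c - A, then B - A is a translate of A + B, so (A, B) is not MSTD; this
    disposes of |A| <= 2 and of three-term progressions.  For |A| = 3, translating
    the pairwise intersections in the inclusion-exclusion formulas for
    A + B = \bigcup (B + a) and B - A = \bigcup (B - a) gives
    |A + B| - |B - A| = T - T', where T and T' count the translates of -A and of A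
    contained in B.  If A is not a progression and |B| <= 4, then T <= 1.  If
    T = 1, then B is a reflected copy of A together with at most one more point:
    either A - B is not symmetric, so that ±(A - B) has more elements than B - A,
    or B is one of a few explicit sets, all of which contain a translate of A. *)

(** * Membership in sums and differences, translates, symmetric sets *)

Lemma sumsetP (A B : {fset int}) (x : int) :
  reflect (exists2 a, a \in A & x - a \in B) (x \in sumset A B).
Proof.
apply: (iffP (imfset2P _ _ _ _ _)) => [[a aA [b bB ->]]|[a aA xaB]].
  by exists a; rewrite // addrC addKr.
by exists a => //; exists (x - a); rewrite // addrC subrK.
Qed.

Lemma diffsetP (A B : {fset int}) (x : int) :
  reflect (exists2 b, b \in B & x + b \in A) (x \in diffset A B).
Proof.
apply: (iffP (imfset2P _ _ _ _ _)) => [[a aA [b bB ->]]|[b bB xbA]].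
  by exists b; rewrite // subrK.
by exists (x + b) => //; exists b; rewrite // addrK.
Qed.

Lemma MSTD_pairC (A B : {fset int}) : MSTD_pair A B = MSTD_pair B A.
Proof.
rewrite /MSTD_pair /pm_diffset fsetUC; congr (_ < #|` _|)%N.
apply/fsetP => x.
by apply/imfset2P/imfset2P => -[a aA [b bB ->]]; exists b => //; exists a => //;
  rewrite addrC.
Qed.

Definition translate (t : int) (B : {fset int}) : {fset int} :=
  [fset b + t | b in B].

Lemma in_translate (t x : int) (B : {fset int}) :
  (x \in translate t B) = (x - t \in B).
Proof.
apply/imfsetP/idP => [[b bB ->]|xB]; first by rewrite addrK.
by exists (x - t); rewrite // subrK.
Qed.

Lemma card_translate (t : int) (B : {fset int}) : #|` translate t B| = #|` B|.
Proof. by rewrite /translate card_imfset //; exact: addIr. Qed.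

Lemma symmetric_not_MSTD (A B : {fset int}) (c : int) :
  {in A, forall a, c - a \in A} -> ~~ MSTD_pair A B.
Proof.
move=> symA; rewrite -leqNgt.
apply: (@leq_trans #|` translate c (diffset B A)|); last first.
  by rewrite card_translate fsubset_leq_card // fsubsetUr.
apply/fsubset_leq_card/fsubsetP => x /sumsetP[a aA xaB].
rewrite in_translate; apply/diffsetP; exists (c - a); first exact: symA.
by rewrite addrA subrK.
Qed.

Lemma fset_int_sorted (A : {fset int}) :
  exists2 s : seq int, sorted <%O s & A = [fset x in s] /\ #|` A| = size s.
Proof.
exists (sort <=%O (enum_fset A)); first by rewrite Order.TotalTheory.sort_lt_sorted fset_uniq.
split; last by rewrite size_sort.
by apply/fsetP => x; rewrite inE /= mem_sort.
Qed.

Lemma card_le2_symmetric (A : {fset int}) :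
  (#|` A| <= 2)%N -> exists c, {in A, forall a, c - a \in A}.
Proof.
have [s _ [-> ->]] := fset_int_sorted A; move: s => [|a1 [|a2 []]] //= _.
- by exists 0 => a; rewrite inE.
- by exists (a1 + a1) => a; rewrite !inE; lia.
- by exists (a1 + a2) => a; rewrite !inE; lia.
Qed.

(** * Inclusion-exclusion over three translates *)

Lemma card_fsetU3 (K : choiceType) (U V W : {fset K}) :
  (#|` U `|` V `|` W| + (#|` U `&` V| + #|` U `&` W| + #|` V `&` W|) =
   #|` U| + #|` V| + #|` W| + #|` U `&` V `&` W|)%N.
Proof.
have := cardfsUI (U `|` V) W; have := cardfsUI U V.
have := cardfsUI (U `&` W) (V `&` W).
rewrite -fsetIUl fsetIACA fsetIid; lia.
Qed.

(** Shifting by [- t - u] carries [B + t] to [B - u] and [B + u] to [B - t]. *)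
Lemma translateI_opp (t u : int) (B : {fset int}) :
  #|` translate t B `&` translate u B| =
  #|` translate (- t) B `&` translate (- u) B|.
Proof.
rewrite -(card_translate (- t - u)); congr #|` _|.
apply/fsetP => x; rewrite !(in_translate, inE) andbC.
by congr (_ && _); congr (_ \in B); lia.
Qed.

Lemma card_sumset3 (a1 a2 a3 : int) (B : {fset int}) (A := [fset a1; a2; a3]) :
  (#|` sumset A B| +
   #|` translate (- a1) B `&` translate (- a2) B `&` translate (- a3) B| =
   #|` diffset B A| +
   #|` translate a1 B `&` translate a2 B `&` translate a3 B|)%N.
Proof.
have -> : sumset A B = translate a1 B `|` translate a2 B `|` translate a3 B.
  apply/fsetP => x; rewrite !(in_translate, inE).
  apply/sumsetP/idP => [[a]|]; first by rewrite !inE => /orP[/orP[]|]/eqP ->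
    ->; rewrite ?orbT.
  by move=> /orP[/orP[]|]; [exists a1|exists a2|exists a3]; rewrite // !inE
    eqxx ?orbT.
have -> : diffset B A =
    translate (- a1) B `|` translate (- a2) B `|` translate (- a3) B.
  apply/fsetP => x; rewrite !(in_translate, inE) !opprK.
  apply/diffsetP/idP => [[a]|]; first by rewrite !inE => /orP[/orP[]|]/eqP ->
    ->; rewrite ?orbT.
  by move=> /orP[/orP[]|]; [exists a1|exists a2|exists a3]; rewrite // !inE
    eqxx ?orbT.
have := card_fsetU3 (translate a1 B) (translate a2 B) (translate a3 B).
have := card_fsetU3 (translate (- a1) B) (translate (- a2) B)
  (translate (- a3) B).
rewrite !card_translate (translateI_opp a1 a2) (translateI_opp a1 a3).
rewrite (translateI_opp a2 a3); lia.
Qed.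

(** * Three elements against at most four *)

Ltac split_mem t :=
  let H := fresh in have H := t;
  destruct H as [H|[H|[H|[H|[H|[H|[H|[H|H]]]]]]]]; try lia.

(* For A = {0, x, x+y}, the set X below is (A+A) \cup (A+f); up to translation
   it is A - B when B consists of a reflected copy of A and one more point. *)
Lemma symmetric_sumset_cases (x y f c : int)
    (X := fun d : int =>
      d = 0 \/ d = x \/ d = x + y \/
      d = x + x \/ d = x + x + y \/ d = x + x + y + y \/
      d = f \/ d = f + x \/ d = f + x + y) :
  0 < x -> 0 < y -> x <> y -> (forall d, X d -> X (c - d)) ->
  (y = x + x /\ (f = y \/ f = y + y)) \/ (x = y + y /\ (f = y \/ f = - y)).
Proof.
move=> x_gt0 y_gt0 neq_xy sym.
have X0 : X 0 by left.
have Xx : X x by rewrite /X; tauto.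
have Xxx : X (x + x) by rewrite /X; tauto.
have Xxxy : X (x + x + y) by rewrite /X; tauto.
have Xm : X (x + x + y + y) by rewrite /X; tauto.
have Xf : X f by rewrite /X; tauto.
have Xfx : X (f + x) by rewrite /X; tauto.
have Xfm : X (f + x + y) by rewrite /X; tauto.
(* c is the sum of the least and the greatest element of X *)
have c_eq : c = f + x + x + y + y /\ f < 0 \/
    c = x + x + y + y /\ 0 <= f <= x + y \/ c = f + x + y /\ x + y < f.
  (* The extremes of [X] are those of the blocks [[0, 2x + 2y]] and [[f, f + x + y]]. Reflecting
     each extreme must stay between them, which fixes [c]. *)
  have [f_lt0|[f_mid|f_gt]] : f < 0 \/ 0 <= f <= x + y \/ x + y < f by lia.
  - by move: (sym _ Xm) (sym _ Xf); rewrite /X; lia.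
  - by move: (sym _ Xm) (sym _ X0); rewrite /X; lia.
  - by move: (sym _ X0) (sym _ Xfm); rewrite /X; lia.
destruct c_eq as [[c_eq f_range]|[[c_eq f_range]|[c_eq f_range]]].
all: split_mem (sym _ Xxxy).
all: split_mem (sym _ Xx).
all: split_mem (sym _ Xfx).
all: split_mem (sym _ Xxx).
Qed.

(** The point [e] may repeat one of the other three, so that [|B| = 3] needs no separate treatment
    later. *)
Lemma card_le4_extension (s a1 a2 a3 : int) (B : {fset int}) :
  a1 < a2 -> a2 < a3 -> (#|` B| <= 4)%N ->
  s - a1 \in B -> s - a2 \in B -> s - a3 \in B ->
  exists e, B = [fset s - a1; s - a2; s - a3; e].
Proof.
move=> lt12 lt23 cardB B1 B2 B3; pose P := [fset s - a1; s - a2; s - a3].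
have PB : P `<=` B.
  by apply/fsubsetP => x; rewrite !inE => /orP[/orP[]|]/eqP ->.
have cardP : #|` P| = 3%N.
  by rewrite /P fsetUC cardfsU1 cardfs2 !inE; lia.
have : (#|` B `\` P| <= 1)%N by rewrite cardfsDS // cardP; lia.
rewrite leq_eqVlt ltnS leqn0 cardfs_eq0 => /orP[/cardfs1P[e BP]|/eqP BP].
  by exists e; rewrite -(fsetID P B) (fsetIidPr PB) BP.
exists (s - a3); rewrite -(fsetID P B) (fsetIidPr PB) BP fsetU0; apply/fsetP => x.
by rewrite !inE -!orbA orbb.
Qed.

Lemma card3_card4_not_MSTD (A B : {fset int}) :
  #|` A| = 3%N -> (#|` B| <= 4)%N -> ~~ MSTD_pair A B.
Proof.
have [s + [AE ->]] := fset_int_sorted A; move: s AE.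
move=> [|a1 [|a2 [|a3 []]]] //= AE /and3P[lt12 lt23 _] _ cardB.
have {}AE : A = [fset a1; a2; a3].
  by rewrite AE; apply/fsetP => x; rewrite !inE; lia.
have [ap|nap] := eqVneq (a2 - a1) (a3 - a2).
  apply: (@symmetric_not_MSTD _ _ (a1 + a3)) => a.
  by rewrite AE !inE; lia.
have := card_sumset3 a1 a2 a3 B; rewrite -AE.
(* [Ip] consists of the [s] with [s - A] inside [B], and [Im] of the [t] with [t + A] inside [B]. *)
set Ip := translate a1 B `&` _ `&` _; set Im := translate (- a1) B `&` _ `&` _.
move=> SD; rewrite -leqNgt /pm_diffset.
have le_pm : (#|` diffset B A| <= #|` diffset A B `|` diffset B A|)%N.
  by rewrite fsubset_leq_card // fsubsetUr.
have [Ip0|[s sIp]] := fset_0Vmem Ip.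
  by move: SD; rewrite Ip0 cardfs0; lia.
move: (sIp); rewrite !(in_translate, inE) => /andP[/andP[sB1 sB2] sB3].
have [e BE] := card_le4_extension lt12 lt23 cardB sB1 sB2 sB3.
(* A second such translate would have at least two points in [s - A], as only one can be [e]; a
   nonzero shift doing this makes [A] a progression. *)
have cardIp : (#|` Ip| <= 1)%N.
  rewrite -(cardfs1 s) fsubset_leq_card //; apply/fsubsetP => x.
  by rewrite !(in_translate, inE) BE !inE; lia.
have [sub|nsub] := boolP (diffset A B `<=` diffset B A); last first.
  have : (#|` diffset B A| < #|` diffset A B `|` diffset B A|)%N.
    rewrite fproper_ltn_card // fproperE fsubsetUr /=.
    by apply: contra nsub; rewrite fsubUset => /andP[].
  by lia.
have symD d : d \in diffset A B -> - d \in diffset A B.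
  move=> /(fsubsetP sub)/diffsetP[a aA daB]; apply/diffsetP.
  by exists (d + a); rewrite ?addKr.
(* The shift sends [a1 - (s - a1)] to 0, so that [A - B] takes the form [X] with gaps [x = a2 - a1],
   [y = a3 - a2] and [f = s - e - a1]. *)
have memD d : d - s + a1 + a1 \in diffset A B <->
    d = 0 \/ d = a2 - a1 \/ d = a2 - a1 + (a3 - a2) \/
    d = a2 - a1 + (a2 - a1) \/ d = a2 - a1 + (a2 - a1) + (a3 - a2) \/
    d = a2 - a1 + (a2 - a1) + (a3 - a2) + (a3 - a2) \/
    d = s - e - a1 \/ d = s - e - a1 + (a2 - a1) \/
    d = s - e - a1 + (a2 - a1) + (a3 - a2).
  split; first by case/diffsetP => b; rewrite AE BE !inE; lia.
  move=> d_eq; apply/diffsetP.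
  case: d_eq => [|[|[|[|[|[|[|[]]]]]]]] ->.
  1-3: by exists (s - a1); rewrite ?AE ?BE !inE; lia.
  1-2: by exists (s - a2); rewrite ?AE ?BE !inE; lia.
  1: by exists (s - a3); rewrite ?AE ?BE !inE; lia.
  1-3: by exists e; rewrite ?AE ?BE !inE; lia.
suff : Im != fset0 by rewrite -cardfs_gt0; lia.
have ImP t : t + a1 \in B -> t + a2 \in B -> t + a3 \in B -> Im != fset0.
  move=> t1 t2 t3; apply/fset0Pn; exists t.
  by rewrite !(in_translate, inE) !opprK t1 t2.
(* In the shifted coordinate, negation becomes [d] to [2s - 4 a1 - d]. *)
have := @symmetric_sumset_cases (a2 - a1) (a3 - a2) (s - e - a1) (s + s - a1 *+ 4).
case=> [|||d /memD/symD d_sym|[xy [f_eq|f_eq]]|[xy [f_eq|f_eq]]].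
- by lia.
- by lia.
- by lia.
- apply/memD; suff -> : s + s - a1 *+ 4 - d - s + a1 + a1 =
    - (d - s + a1 + a1) by [].
  by lia.
(* Let [g] be the smaller gap of [A]. If [f = y], then [B] is a four-term progression of step [g],
   and the copy of [A] starts at its least point [s - a3]. Otherwise [B] is a translate of
   [{0, g, 3g, 4g}], and the copy starts at its first point [e] or its second point [s - a2]. *)
- by apply: (ImP (s - a1 - a3)); rewrite BE !inE; lia.
- by apply: (ImP (e - a1)); rewrite BE !inE; lia.
- by apply: (ImP (s - a1 - a3)); rewrite BE !inE; lia.
- by apply: (ImP (s - a1 - a2)); rewrite BE !inE; lia.
Qed.

Lemma MSTD_size_ge (A B : {fset int}) :
  MSTD_pair A B ->
  [|| (3 <= #|` A|)%N && (5 <= #|` B|)%N, (5 <= #|` A|)%N && (3 <= #|` B|)%N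
    | (4 <= #|` A|)%N && (4 <= #|` B|)%N].
Proof.
move=> AB; have BA : MSTD_pair B A by rewrite MSTD_pairC.
have gt2 A' B' : MSTD_pair A' B' -> (2 < #|` A'|)%N.
  rewrite ltnNge => MAB; apply/negP => /card_le2_symmetric[c symA].
  by move: MAB; apply/negP/symmetric_not_MSTD/symA.
have gt4 A' B' : MSTD_pair A' B' -> #|` A'| = 3%N -> (4 < #|` B'|)%N.
  move=> MAB A3; rewrite ltnNge; apply: contraL MAB.
  exact: card3_card4_not_MSTD.
move: (gt2 _ _ AB) (gt2 _ _ BA) (gt4 _ _ AB) (gt4 _ _ BA); lia.
Qed.

(** * Explicit examples and the minimal sizes *)

Lemma imfset2_seq (f : int -> int -> int) (s t : seq int) :
  [fset f a b | a in [fset x in s], b in [fset x in t]] =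
  [fset x in [seq f a b | a <- s, b <- t]].
Proof.
apply/fsetP => x; rewrite [RHS]in_fset.
apply/imfset2P/allpairsPdep => [[a + [b + ->]]|[a [b [aA bB ->]]]].
  by rewrite !inE => aA bB; exists a, b.
by exists a; rewrite ?inE //; exists b; rewrite ?inE.
Qed.

(** For explicit lists the right-hand side is decided by evaluation. *)
Lemma MSTD_pair_seq (s t : seq int)
    (S := [seq a + b | a <- s, b <- t])
    (D := [seq a - b | a <- s, b <- t] ++ [seq a - b | a <- t, b <- s]) :
  MSTD_pair [fset x in s] [fset x in t] = (size (undup D) < size (undup S))%N.
Proof.
rewrite /MSTD_pair /pm_diffset /sumset /diffset !imfset2_seq -!card_fseq.
by congr (#|` _| < _)%N; apply/fsetP => x; rewrite in_fsetU !in_fset mem_cat.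
Qed.

Theorem theorem1p5 :
  let A1 : {fset int} := [fset 0; 1; 4; 6; 7] in
  let B1 : {fset int} := [fset 2; 3; 5] in
  let A2 : {fset int} := [fset 0; 1; 4; 6] in
  let B2 : {fset int} := [fset 0; 2; 5; 6] in
  [/\ (* the minimal sizes, up to interchanging the two sets *)
      forall m m' : nat,
        minimal_size (m, m') <->
        (m, m') \in [:: (3, 5); (5, 3); (4, 4)]%N,
      (* the given examples; the first pair is listed with its larger set first *)
      MSTD_pair A1 B1 /\ pair_size B1 A1 = (3, 5)%N,
      MSTD_pair A2 B2 /\ pair_size A2 B2 = (4, 4)%N
    & (* minimality, spelled out for sets of nonnegative integers *)
      forall A B : {fset int},
        (forall a, a \in A -> 0 <= a) -> (forall b, b \in B -> 0 <= b) ->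
        MSTD_pair A B ->
        forall m m' : nat,
          (m, m') \in [:: (3, 5); (5, 3); (4, 4)]%N ->
          pair_size A B <> (m, m') ->
          (m < #|` A|)%N \/ (m' < #|` B|)%N].
Proof.
move=> A1 B1 A2 B2.
have A1E : A1 = [fset x in [:: 0; 1; 4; 6; 7]].
  by apply/fsetP => x; rewrite !inE; lia.
have B1E : B1 = [fset x in [:: 2; 3; 5]].
  by apply/fsetP => x; rewrite !inE; lia.
have A2E : A2 = [fset x in [:: 0; 1; 4; 6]].
  by apply/fsetP => x; rewrite !inE; lia.
have B2E : B2 = [fset x in [:: 0; 2; 5; 6]].
  by apply/fsetP => x; rewrite !inE; lia.
have M1 : MSTD_pair A1 B1 by rewrite A1E B1E MSTD_pair_seq; vm_compute.
have M2 : MSTD_pair A2 B2 by rewrite A2E B2E MSTD_pair_seq; vm_compute.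
have S1 : pair_size B1 A1 = (3, 5)%N by rewrite /pair_size A1E B1E !card_fseq.
have S1' : pair_size A1 B1 = (5, 3)%N by case: S1 => *; congr (_, _).
have S2 : pair_size A2 B2 = (4, 4)%N by rewrite /pair_size A2E B2E !card_fseq.
have M1' : MSTD_pair B1 A1 by rewrite MSTD_pairC.
have lower A B m m' : MSTD_pair A B ->
    (m, m') \in [:: (3, 5); (5, 3); (4, 4)]%N -> pair_size A B <> (m, m') ->
    (m < #|` A|)%N \/ (m' < #|` B|)%N.
  move=> /MSTD_size_ge + + neq; rewrite !inE !xpair_eqE.
  suff : ~ (#|` A| = m /\ #|` B| = m') by lia.
  by case=> eqA eqB; apply: neq; rewrite /pair_size eqA eqB.
split=> // [m m'|A B _ _ MAB m m']; last exact: lower.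
split=> [[[A [B [MAB [eqA eqB]]]] minAB]|mem].
  have not_above A' B' : MSTD_pair A' B' ->
      pair_size A' B' = (m, m') \/ (m < #|` A'|)%N \/ (m' < #|` B'|)%N.
    move=> MAB'; have [->|/eqP neq] := eqVneq (pair_size A' B') (m, m').
      by left.
    by right; exact: minAB.
  (* The size [(m, m')] dominates that of one of the three examples, and minimality tested on this
     example forces equality. *)
  have := MSTD_size_ge MAB; rewrite eqA eqB !inE !xpair_eqE.
  move: (not_above _ _ M1) (not_above _ _ M1') (not_above _ _ M2).
  case: S1 S2 => B1card A1card [A2card B2card].
  rewrite /pair_size A1card B1card A2card B2card.
  have pairE (i j : nat) : (i, j) = (m, m') -> i = m /\ j = m' by case.
  by move=> [/pairE H1|H1] [/pairE H2|H2] [/pairE H3|H3]; lia.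
split; last by move=> A B MAB; apply: lower.
move: mem; rewrite !inE => /or3P[]/eqP ->.
- by exists B1, A1.
- by exists A1, B1.
- by exists A2, B2.
Qed.
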